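(* For the reflection $H\vdash I:2Cat\rightarrow 2Preord$, the class $\mathcal{E}'_I$ is a proper subclass of $\mathcal{E}_I$; therefore the monotone-light factorization system $(\mathcal{E}'_I,\mathcal{M}^*_I)$ is non-trivial, i.e. $(\mathcal{E}'_I,\mathcal{M}^*_I)\neq(\mathcal{E}_I,\mathcal{M}_I)$.
   Context: $2Cat$ is the category of all (small, strict) 2-categories and 2-functors. $2Preord$ is its full subcategory of 2-preorders, i.e. those 2-categories in which any two 2-cells with the same vertical domain and the same vertical codomain are equal. $H:2Preord\to 2Cat$ is the full inclusion; its left adjoint $I$ keeps objects and 1-cells and identifies all 2-cells having the same vertical domain and the same vertical codomain. The unit is $\eta:1_{2Cat}\to HI$. $\mathcal{E}_I$ is the class of 2-functors $f$ such that $I(f)$ is an isomorphism. $\mathcal{M}_I$ is the class of 2-functors $f:A\to B$ for which the naturality square $HI(f)\circ\eta_A=\eta_B\circ f$ is a pullback. $\mathcal{E}'_I$ is the largest subclass of $\mathcal{E}_I$ stable under pullbacks: $f:A\to B$ is in $\mathcal{E}'_I$ iff for every 2-functor $g:C\to B$ the projection $C\times_B A\to C$ is in $\mathcal{E}_I$. $\mathcal{M}^*_I$ is the class of 2-functors $f:A\to B$ for which there exists an effective descent morphism $p:C\to B$ in $2Cat$ (i.e. a 2-functor such that the pullback functor $p^*:2Cat/B\to 2Cat/C$ is monadic) such that the projection $p^*(f):C\times_BA\to C$ is in $\mathcal{M}_I$. *)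

(* Defs.v *)
From Stdlib Require Import FunctionalExtensionality ProofIrrelevance.
From Stdlib Require Import ClassicalEpsilon.

Set Implicit Arguments.
Unset Strict Implicit.
Unset Printing Implicit Defensive.

Lemma sig_eq (T : Type) (P : T -> Prop) (x y : sig P) :
  proj1_sig x = proj1_sig y -> x = y.
Proof.
destruct x as [x px], y as [y py]; simpl; intros ->.
f_equal; apply proof_irrelevance.
Qed.

Record Category := {
  Ob :> Type;
  Hom : Ob -> Ob -> Type;
  ident : forall x, Hom x x;
  comp : forall x y z, Hom y z -> Hom x y -> Hom x z;
  comp_idl : forall x y (f : Hom x y), comp (ident y) f = f;
  comp_idr : forall x y (f : Hom x y), comp f (ident x) = f;
  comp_assoc : forall x y z t (h : Hom z t) (g : Hom y z) (f : Hom x y),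
    comp (comp h g) f = comp h (comp g f)
}.
Arguments Hom {c} _ _.
Arguments ident {c} _.
Arguments comp {c} [x y z] _ _.

Definition is_iso (C : Category) (x y : C) (f : Hom x y) : Prop :=
  exists g : Hom y x, comp g f = ident x /\ comp f g = ident y.

Record Functor (C D : Category) := {
  fobj :> C -> D;
  fmap : forall x y, Hom x y -> Hom (fobj x) (fobj y);
  fmap_id : forall x, fmap (ident x) = ident (fobj x);
  fmap_comp : forall x y z (g : Hom y z) (f : Hom x y),
    fmap (comp g f) = comp (fmap g) (fmap f)
}.
Arguments fmap {C D} _ [x y] _.

Definition functor_id (C : Category) : Functor C C.
Proof.
refine {| fobj x := x; fmap x y f := f |}; reflexivity.
Defined.

Definition functor_comp (C D E : Category) (G : Functor D E) (F : Functor C D) :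
  Functor C E.
Proof.
refine {| fobj x := G (F x); fmap x y f := fmap G (fmap F f) |}.
- abstract (intros x; rewrite !fmap_id; reflexivity).
- abstract (intros x y z g f; rewrite !fmap_comp; reflexivity).
Defined.

Record NatTrans (C D : Category) (F G : Functor C D) := {
  component :> forall x, Hom (F x) (G x);
  naturality : forall x y (f : Hom x y),
    comp (fmap G f) (component x) = comp (component y) (fmap F f)
}.

Definition naturally_isomorphic (C D : Category) (F G : Functor C D) : Prop :=
  exists t : NatTrans F G, forall x, is_iso (t x).

Definition is_equivalence (C D : Category) (F : Functor C D) : Prop :=
  exists G : Functor D C,
    naturally_isomorphic (functor_comp G F) (functor_id C) /\
    naturally_isomorphic (functor_comp F G) (functor_id D).

(** [Adjunction F G]: [F] is left adjoint to [G]. *)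
Record Adjunction (C D : Category) (F : Functor C D) (G : Functor D C) := {
  adj_unit : NatTrans (functor_id C) (functor_comp G F);
  adj_counit : NatTrans (functor_comp F G) (functor_id D);
  triangle_left : forall x, comp (adj_counit (F x)) (fmap F (adj_unit x)) = ident (F x);
  triangle_right : forall y, comp (fmap G (adj_counit y)) (adj_unit (G y)) = ident (G y)
}.

Record Monad (C : Category) := {
  endo :> Functor C C;
  eta : NatTrans (functor_id C) endo;
  mu : NatTrans (functor_comp endo endo) endo;
  mu_eta_left : forall x, comp (mu x) (eta (endo x)) = ident (endo x);
  mu_eta_right : forall x, comp (mu x) (fmap endo (eta x)) = ident (endo x);
  mu_assoc : forall x, comp (mu x) (mu (endo x)) = comp (mu x) (fmap endo (mu x))
}.

Definition adjunction_monad (C D : Category) (F : Functor C D) (G : Functor D C)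
  (adj : Adjunction F G) : Monad C.
Proof.
unshelve refine {|
  endo := functor_comp G F;
  eta := adj_unit adj;
  mu := @Build_NatTrans C C
    (functor_comp (functor_comp G F) (functor_comp G F)) (functor_comp G F)
    (fun x => fmap G (adj_counit adj (F x))) _
|}.
- abstract (intros x y f; simpl; rewrite <- !fmap_comp; f_equal;
  exact (naturality (adj_counit adj) (fmap F f))).
- abstract (intros x; exact (triangle_right adj (F x))).
- abstract (intros x; simpl; rewrite <- fmap_comp, <- fmap_id; f_equal;
  exact (triangle_left adj x)).
- abstract (intros x; simpl; rewrite <- !fmap_comp; f_equal;
  exact (naturality (adj_counit adj) (adj_counit adj (F x)))).
Defined.

Record Algebra (C : Category) (T : Monad C) := {
  carrier : C;
  action : Hom (T carrier) carrier;
  action_unit : comp action (eta T carrier) = ident carrier;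
  action_mu : comp action (mu T carrier) = comp action (fmap T action)
}.

Definition eilenberg_moore (C : Category) (T : Monad C) : Category.
Proof.
unshelve refine {|
  Ob := Algebra T;
  Hom a b := {f : Hom (carrier a) (carrier b) |
              comp f (action a) = comp (action b) (fmap T f)};
  ident a := exist _ (ident (carrier a)) _;
  comp a b c g f := exist _ (comp (proj1_sig g) (proj1_sig f)) _
|}.
- abstract (simpl; rewrite fmap_id, comp_idl, comp_idr; reflexivity).
- abstract (destruct f as [f ef], g as [g eg]; simpl;
  rewrite comp_assoc, ef, <- comp_assoc, eg, comp_assoc, fmap_comp; reflexivity).
- abstract (intros; apply sig_eq, comp_idl).
- abstract (intros; apply sig_eq, comp_idr).
- abstract (intros; apply sig_eq, comp_assoc).
Defined.

Definition comparison (C D : Category) (F : Functor C D) (G : Functor D C)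
  (adj : Adjunction F G) :
  Functor D (eilenberg_moore (adjunction_monad adj)).
Proof.
unshelve refine {|
  fobj y := (@Build_Algebra C (adjunction_monad adj) (G y)
               (fmap G (adj_counit adj y)) _ _
             : Ob (eilenberg_moore (adjunction_monad adj)));
  fmap x y f := exist _ (fmap G f) _
|}.
- abstract (apply triangle_right).
- abstract (simpl; rewrite <- !fmap_comp; f_equal;
  exact (naturality (adj_counit adj) (adj_counit adj y))).
- abstract (simpl; rewrite <- !fmap_comp; f_equal;
  exact (naturality (adj_counit adj) f)).
- abstract (intros; apply sig_eq, fmap_id).
- abstract (intros; apply sig_eq, fmap_comp).
Defined.

Definition monadic (C D : Category) (G : Functor D C) : Prop :=
  exists (F : Functor C D) (adj : Adjunction F G), is_equivalence (comparison adj).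

Record is_pullback (C : Category) (P A B D : C) (p1 : Hom P A) (p2 : Hom P B)
  (f : Hom A D) (g : Hom B D) : Prop := {
  square_comm : comp f p1 = comp g p2;
  square_univ : forall (Q : C) (q1 : Hom Q A) (q2 : Hom Q B),
    comp f q1 = comp g q2 -> exists! u : Hom Q P, comp p1 u = q1 /\ comp p2 u = q2
}.

Record Pullback (C : Category) (A B D : C) (f : Hom A D) (g : Hom B D) := {
  apex : C;
  pr1 : Hom apex A;
  pr2 : Hom apex B;
  pr_comm : comp f pr1 = comp g pr2;
  pairing : forall (Q : C) (q1 : Hom Q A) (q2 : Hom Q B),
    comp f q1 = comp g q2 -> Hom Q apex;
  pr1_pairing : forall (Q : C) (q1 : Hom Q A) (q2 : Hom Q B) e,
    comp pr1 (@pairing Q q1 q2 e) = q1;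
  pr2_pairing : forall (Q : C) (q1 : Hom Q A) (q2 : Hom Q B) e,
    comp pr2 (@pairing Q q1 q2 e) = q2;
  pairing_uniq : forall (Q : C) (u v : Hom Q apex),
    comp pr1 u = comp pr1 v -> comp pr2 u = comp pr2 v -> u = v
}.
Arguments pairing {C A B D f g} _ {Q} _ _ _.

Definition Pullbacks (C : Category) : Type :=
  forall (A B D : C) (f : Hom A D) (g : Hom B D), Pullback f g.

Definition slice (C : Category) (B : C) : Category.
Proof.
unshelve refine {|
  Ob := {E : C & Hom E B};
  Hom a b := {u : Hom (projT1 a) (projT1 b) | comp (projT2 b) u = projT2 a};
  ident a := exist _ (ident (projT1 a)) _;
  comp a b c v u := exist _ (comp (proj1_sig v) (proj1_sig u)) _
|}.
- abstract (apply comp_idr).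
- abstract (destruct u as [u eu], v as [v ev]; simpl;
  rewrite <- comp_assoc, ev; exact eu).
- abstract (intros; apply sig_eq, comp_idl).
- abstract (intros; apply sig_eq, comp_idr).
- abstract (intros; apply sig_eq, comp_assoc).
Defined.

Definition pullback_functor (C : Category) (pb : Pullbacks C) (E B : C)
  (p : Hom E B) : Functor (slice B) (slice E).
Proof.
unshelve refine (@Build_Functor (slice B) (slice E)
  (fun a => existT (fun X => Hom X E)
    (apex (pb _ _ _ p (projT2 a))) (pr1 (pb _ _ _ p (projT2 a))))
  (fun a b u => exist _
    (pairing (pb _ _ _ p (projT2 b)) (pr1 (pb _ _ _ p (projT2 a)))
       (comp (proj1_sig u) (pr2 (pb _ _ _ p (projT2 a)))) _) _)
  _ _).
- abstract (rewrite <- comp_assoc, (proj2_sig u); apply pr_comm).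
- abstract (apply pr1_pairing).
- intros x; apply sig_eq, pairing_uniq; simpl.
  + rewrite pr1_pairing, comp_idr; reflexivity.
  + rewrite pr2_pairing, comp_idl, comp_idr; reflexivity.
- intros x y z g f; apply sig_eq, pairing_uniq; simpl.
  + rewrite <- comp_assoc, !pr1_pairing; reflexivity.
  + rewrite <- comp_assoc, !pr2_pairing, !comp_assoc, pr2_pairing; reflexivity.
Defined.

Definition effective_descent (C : Category) (pb : Pullbacks C) (E B : C)
  (p : Hom E B) : Prop :=
  monadic (pullback_functor pb p).

Definition MorphismClass (C : Category) : Type := forall A B : C, Hom A B -> Prop.

Definition proper_subclass (C : Category) (K L : MorphismClass C) : Prop :=
  (forall (A B : C) (f : Hom A B), K A B f -> L A B f) /\
  (exists (A B : C) (f : Hom A B), L A B f /\ ~ K A B f).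

Definition inverted_class (C D : Category) (I : Functor C D) : MorphismClass C :=
  fun A B f => is_iso (fmap I f).

Definition cartesian_class (C D : Category) (I : Functor C D) (H : Functor D C)
  (adj : Adjunction I H) : MorphismClass C :=
  fun A B f => is_pullback f (adj_unit adj A) (adj_unit adj B) (fmap H (fmap I f)).

(** The pullbacks below are the chosen ones; [inverted_class] and
    [cartesian_class] are invariant under isomorphism, so the choice is
    immaterial. *)
Definition stabilized_class (C : Category) (pb : Pullbacks C)
  (K : MorphismClass C) : MorphismClass C :=
  fun A B f => forall (E : C) (g : Hom E B), K _ _ (pr1 (pb _ _ _ g f)).

Definition localized_class (C : Category) (pb : Pullbacks C)
  (K : MorphismClass C) : MorphismClass C :=
  fun A B f => exists (E : C) (p : Hom E B),
    effective_descent pb p /\ K _ _ (pr1 (pb _ _ _ p f)).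

Definition full_subcategory (C : Category) (P : C -> Prop) : Category.
Proof.
refine {|
  Ob := {x : C | P x};
  Hom x y := Hom (proj1_sig x) (proj1_sig y);
  ident x := ident (proj1_sig x);
  comp x y z g f := comp g f
|}.
- abstract (intros; apply comp_idl).
- abstract (intros; apply comp_idr).
- abstract (intros; apply comp_assoc).
Defined.

Definition full_inclusion (C : Category) (P : C -> Prop) :
  Functor (full_subcategory P) C.
Proof.
refine {| fobj (x : full_subcategory P) := proj1_sig x : Ob C;
          fmap x y (f : Hom x y) := f |}; reflexivity.
Defined.

(** A category with set of objects [O] and set of arrows [A], presented by
    source, target, identities and composition of composable pairs.  The laws
    quantify over all proofs of composability; those proofs exist by the
    preceding fields.  Keeping cells in plain sets, instead of families indexed
    by boundaries, makes the strict laws equations without transport. *)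
Record cat_on (O A : Type) := {
  src : A -> O;
  tgt : A -> O;
  idn : O -> A;
  cmp : forall g f : A, src g = tgt f -> A;
  src_idn : forall x, src (idn x) = x;
  tgt_idn : forall x, tgt (idn x) = x;
  src_cmp : forall g f e, src (@cmp g f e) = src f;
  tgt_cmp : forall g f e, tgt (@cmp g f e) = tgt g;
  cmp_idl : forall f e, @cmp (idn (tgt f)) f e = f;
  cmp_idr : forall f e, @cmp f (idn (src f)) e = f;
  cmp_assoc : forall h g f e1 e2 e3 e4,
    @cmp (@cmp h g e1) f e2 = @cmp h (@cmp g f e3) e4
}.
Arguments cmp {O A} _ _ _ _.

Record functor_on (O A O' A' : Type) (X : cat_on O A) (Y : cat_on O' A')
  (F0 : O -> O') (F1 : A -> A') : Prop := {
  on_src : forall f, src Y (F1 f) = F0 (src X f);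
  on_tgt : forall f, tgt Y (F1 f) = F0 (tgt X f);
  on_idn : forall x, F1 (idn X x) = idn Y (F0 x);
  on_cmp : forall g f e e', F1 (cmp X g f e) = cmp Y (F1 g) (F1 f) e'
}.

Record TwoCat := {
  cell0 : Type;
  cell1 : Type;
  cell2 : Type;
  base : cat_on cell0 cell1;
  vert : cat_on cell1 cell2;
  horiz : cat_on cell0 cell2;
  src_src : forall a, src base (src vert a) = src horiz a;
  src_tgt : forall a, src base (tgt vert a) = src horiz a;
  tgt_src : forall a, tgt base (src vert a) = tgt horiz a;
  tgt_tgt : forall a, tgt base (tgt vert a) = tgt horiz a;
  idn_idn : forall x, idn vert (idn base x) = idn horiz x;
  src_hcmp : forall b a e e',
    src vert (cmp horiz b a e) = cmp base (src vert b) (src vert a) e';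
  tgt_hcmp : forall b a e e',
    tgt vert (cmp horiz b a e) = cmp base (tgt vert b) (tgt vert a) e';
  idn_hcmp : forall g f e e',
    idn vert (cmp base g f e) = cmp horiz (idn vert g) (idn vert f) e';
  interchange : forall b' b a' a vb va h' h e e',
    cmp horiz (cmp vert b' b vb) (cmp vert a' a va) e =
    cmp vert (cmp horiz b' a' h') (cmp horiz b a h) e'
}.

Record TwoFunctor (A B : TwoCat) := {
  map0 : cell0 A -> cell0 B;
  map1 : cell1 A -> cell1 B;
  map2 : cell2 A -> cell2 B;
  map_base : functor_on (base A) (base B) map0 map1;
  map_vert : functor_on (vert A) (vert B) map1 map2;
  map_horiz : functor_on (horiz A) (horiz B) map0 map2
}.

Lemma TwoFunctor_eq (A B : TwoCat) (F G : TwoFunctor A B) :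
  (forall x, map0 F x = map0 G x) -> (forall f, map1 F f = map1 G f) ->
  (forall a, map2 F a = map2 G a) -> F = G.
Proof.
destruct F as [F0 F1 F2 Fb Fv Fh], G as [G0 G1 G2 Gb Gv Gh]; simpl.
intros e0 e1 e2.
apply functional_extensionality in e0; apply functional_extensionality in e1;
apply functional_extensionality in e2; subst.
f_equal; apply proof_irrelevance.
Qed.

Lemma cmp_congr (O A : Type) (X : cat_on O A) g g' f f' e e' :
  g = g' -> f = f' -> cmp X g f e = cmp X g' f' e'.
Proof.
intros; subst; f_equal; apply proof_irrelevance.
Qed.

Lemma cmp_idl_at (O A : Type) (X : cat_on O A) x f e :
  x = tgt X f -> cmp X (idn X x) f e = f.
Proof. intros ->; apply cmp_idl. Qed.

Lemma cmp_idr_at (O A : Type) (X : cat_on O A) x f e :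
  x = src X f -> cmp X f (idn X x) e = f.
Proof. intros ->; apply cmp_idr. Qed.

Lemma functor_on_id (O A : Type) (X : cat_on O A) :
  functor_on X X (fun x => x) (fun f => f).
Proof.
split; try reflexivity; intros; apply cmp_congr; reflexivity.
Qed.

Lemma functor_on_comp (O A O' A' O'' A'' : Type) (X : cat_on O A)
  (Y : cat_on O' A') (Z : cat_on O'' A'') F0 F1 G0 G1 :
  functor_on Y Z G0 G1 -> functor_on X Y F0 F1 ->
  functor_on X Z (fun x => G0 (F0 x)) (fun f => G1 (F1 f)).
Proof.
intros G F; split.
- intros f; rewrite (on_src G), (on_src F); reflexivity.
- intros f; rewrite (on_tgt G), (on_tgt F); reflexivity.
- intros x; rewrite (on_idn F), (on_idn G); reflexivity.
- intros g f e e'.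
  assert (e1 : src Y (F1 g) = tgt Y (F1 f))
    by (rewrite (on_src F), (on_tgt F), e; reflexivity).
  rewrite (on_cmp F e e1); apply (on_cmp G).
Qed.

Definition twofunctor_id (A : TwoCat) : TwoFunctor A A :=
  {| map_base := functor_on_id (base A);
     map_vert := functor_on_id (vert A);
     map_horiz := functor_on_id (horiz A) |}.

Definition twofunctor_comp (A B C : TwoCat) (G : TwoFunctor B C)
  (F : TwoFunctor A B) : TwoFunctor A C :=
  {| map_base := functor_on_comp (map_base G) (map_base F);
     map_vert := functor_on_comp (map_vert G) (map_vert F);
     map_horiz := functor_on_comp (map_horiz G) (map_horiz F) |}.

Definition TwoCAT : Category.
Proof.
refine {|
  Ob := TwoCat;
  Hom := TwoFunctor;
  ident := twofunctor_id;
  comp A B C G F := twofunctor_comp G F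
|}; intros; apply TwoFunctor_eq; reflexivity.
Defined.

Definition fibprod (X Y Z : Type) (f : X -> Z) (g : Y -> Z) : Type :=
  {p : X * Y | f (fst p) = g (snd p)}.

Definition fib1 (X Y Z : Type) (f : X -> Z) (g : Y -> Z) (p : fibprod f g) : X :=
  fst (proj1_sig p).
Definition fib2 (X Y Z : Type) (f : X -> Z) (g : Y -> Z) (p : fibprod f g) : Y :=
  snd (proj1_sig p).

Lemma fibprod_eq (X Y Z : Type) (f : X -> Z) (g : Y -> Z) (p q : fibprod f g) :
  fib1 p = fib1 q -> fib2 p = fib2 q -> p = q.
Proof.
intros e1 e2; apply sig_eq.
rewrite (surjective_pairing (proj1_sig p)), (surjective_pairing (proj1_sig q)).
f_equal; assumption.
Qed.

Lemma fibprod_comm (X Y Z : Type) (f : X -> Z) (g : Y -> Z) (p : fibprod f g) :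
  f (fib1 p) = g (fib2 p).
Proof. exact (proj2_sig p). Qed.

Definition fibprod_cat (O1 A1 O2 A2 O A : Type) (X : cat_on O1 A1)
  (Y : cat_on O2 A2) (Z : cat_on O A) F0 F1 G0 G1
  (F : functor_on X Z F0 F1) (G : functor_on Y Z G0 G1) :
  cat_on (fibprod F0 G0) (fibprod F1 G1).
Proof.
unshelve refine {|
  src p := exist _ (src X (fib1 p), src Y (fib2 p)) _;
  tgt p := exist _ (tgt X (fib1 p), tgt Y (fib2 p)) _;
  idn x := exist _ (idn X (fib1 x), idn Y (fib2 x)) _;
  cmp q p e := exist _ (cmp X (fib1 q) (fib1 p) (f_equal (@fib1 _ _ _ _ _) e),
                        cmp Y (fib2 q) (fib2 p) (f_equal (@fib2 _ _ _ _ _) e)) _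
|}.
- abstract (simpl; rewrite <- (on_src F), <- (on_src G), fibprod_comm; reflexivity).
- abstract (simpl; rewrite <- (on_tgt F), <- (on_tgt G), fibprod_comm; reflexivity).
- abstract (simpl; rewrite (on_idn F), (on_idn G), fibprod_comm; reflexivity).
- simpl.
  pose proof (f_equal (@fib1 _ _ _ _ _) e) as eX; simpl in eX.
  pose proof (f_equal (@fib2 _ _ _ _ _) e) as eY; simpl in eY.
  unshelve erewrite (on_cmp F), (on_cmp G).
  + rewrite (on_src F), (on_tgt F); f_equal; exact eX.
  + rewrite (on_src G), (on_tgt G); f_equal; exact eY.
  + apply cmp_congr; apply fibprod_comm.
- abstract (intros; apply fibprod_eq; apply src_idn).
- abstract (intros; apply fibprod_eq; apply tgt_idn).
- abstract (intros; apply fibprod_eq; apply src_cmp).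
- abstract (intros; apply fibprod_eq; apply tgt_cmp).
- abstract (intros; apply fibprod_eq; apply cmp_idl).
- abstract (intros; apply fibprod_eq; apply cmp_idr).
- abstract (intros; apply fibprod_eq; apply cmp_assoc).
Defined.

Definition fibprod_2cat (A B D : TwoCat) (F : TwoFunctor A D) (G : TwoFunctor B D) :
  TwoCat.
Proof.
refine {|
  base := fibprod_cat (map_base F) (map_base G);
  vert := fibprod_cat (map_vert F) (map_vert G);
  horiz := fibprod_cat (map_horiz F) (map_horiz G)
|}; intros; apply fibprod_eq; cbn.
1, 2: apply src_src.
1, 2: apply src_tgt.
1, 2: apply tgt_src.
1, 2: apply tgt_tgt.
1, 2: apply idn_idn.
1, 2: apply src_hcmp.
1, 2: apply tgt_hcmp.
1, 2: apply idn_hcmp.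
1, 2: apply interchange.
Defined.

Definition fibprod_pr1 (A B D : TwoCat) (F : TwoFunctor A D) (G : TwoFunctor B D) :
  TwoFunctor (fibprod_2cat F G) A.
Proof.
refine (@Build_TwoFunctor (fibprod_2cat F G) A
  (@fib1 _ _ _ _ _) (@fib1 _ _ _ _ _) (@fib1 _ _ _ _ _) _ _ _);
split; try reflexivity; intros; apply cmp_congr; reflexivity.
Defined.

Definition fibprod_pr2 (A B D : TwoCat) (F : TwoFunctor A D) (G : TwoFunctor B D) :
  TwoFunctor (fibprod_2cat F G) B.
Proof.
refine (@Build_TwoFunctor (fibprod_2cat F G) B
  (@fib2 _ _ _ _ _) (@fib2 _ _ _ _ _) (@fib2 _ _ _ _ _) _ _ _);
split; try reflexivity; intros; apply cmp_congr; reflexivity.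
Defined.

Definition fibprod_pairing (A B D : TwoCat) (F : TwoFunctor A D)
  (G : TwoFunctor B D) (Q : TwoCat) (U : TwoFunctor Q A) (V : TwoFunctor Q B)
  (e : twofunctor_comp F U = twofunctor_comp G V) :
  TwoFunctor Q (fibprod_2cat F G).
Proof.
refine (@Build_TwoFunctor Q (fibprod_2cat F G)
  (fun x => exist _ (map0 U x, map0 V x) (f_equal (fun K => map0 K x) e))
  (fun x => exist _ (map1 U x, map1 V x) (f_equal (fun K => map1 K x) e))
  (fun x => exist _ (map2 U x, map2 V x) (f_equal (fun K => map2 K x) e)) _ _ _);
split; intros; apply fibprod_eq; cbn.
all: try apply (on_src (map_base _)).
all: try apply (on_tgt (map_base _)).
all: try apply (on_idn (map_base _)).
all: try apply (on_cmp (map_base _)).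
all: try apply (on_src (map_vert _)).
all: try apply (on_tgt (map_vert _)).
all: try apply (on_idn (map_vert _)).
all: try apply (on_cmp (map_vert _)).
all: try apply (on_src (map_horiz _)).
all: try apply (on_tgt (map_horiz _)).
all: try apply (on_idn (map_horiz _)).
all: try apply (on_cmp (map_horiz _)).
Defined.

Definition TwoCAT_pullbacks : Pullbacks TwoCAT.
Proof.
intros A B D F G.
refine (@Build_Pullback TwoCAT A B D F G (fibprod_2cat F G)
  (fibprod_pr1 F G) (fibprod_pr2 F G) _ (@fibprod_pairing A B D F G) _ _ _).
- abstract (apply TwoFunctor_eq; intros x; apply fibprod_comm).
- abstract (intros; apply TwoFunctor_eq; reflexivity).
- abstract (intros; apply TwoFunctor_eq; reflexivity).
- intros Q U V e1 e2; apply TwoFunctor_eq; intros x; apply fibprod_eq.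
  + exact (f_equal (fun K : TwoFunctor Q A => map0 K x) e1).
  + exact (f_equal (fun K : TwoFunctor Q B => map0 K x) e2).
  + exact (f_equal (fun K : TwoFunctor Q A => map1 K x) e1).
  + exact (f_equal (fun K : TwoFunctor Q B => map1 K x) e2).
  + exact (f_equal (fun K : TwoFunctor Q A => map2 K x) e1).
  + exact (f_equal (fun K : TwoFunctor Q B => map2 K x) e2).
Defined.

Definition is_2preorder (A : TwoCat) : Prop :=
  forall a b : cell2 A,
    src (vert A) a = src (vert A) b -> tgt (vert A) a = tgt (vert A) b -> a = b.

Definition TwoPREORD : Category := full_subcategory (C := TwoCAT) is_2preorder.

Definition inclusionH : Functor TwoPREORD TwoCAT :=
  full_inclusion (C := TwoCAT) is_2preorder.

(** The quotient of the set of 2-cells by the relation "same vertical source and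
    same vertical target", realised as the image of [(src, tgt)] in pairs of
    1-cells. *)
Definition quot2 (A : TwoCat) : Type :=
  {p : cell1 A * cell1 A |
    exists a : cell2 A, (src (vert A) a, tgt (vert A) a) = p}.

Definition quot2_vert (A : TwoCat) : cat_on (cell1 A) (quot2 A).
Proof.
unshelve refine {|
  src p := fst (proj1_sig p);
  tgt p := snd (proj1_sig p);
  idn f := exist _ (f, f) _;
  cmp q p e := exist _ (fst (proj1_sig p), snd (proj1_sig q)) _
|}.
- abstract (exists (idn (vert A) f); rewrite src_idn, tgt_idn; reflexivity).
- abstract (destruct p as [p [a <-]], q as [q [b <-]]; simpl in e |- *;
  exists (cmp (vert A) b a e); rewrite src_cmp, tgt_cmp; reflexivity).
- reflexivity.
- reflexivity.
- reflexivity.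
- reflexivity.
- abstract (intros [[f g] p] e; apply sig_eq; reflexivity).
- abstract (intros [[f g] p] e; apply sig_eq; reflexivity).
- abstract (intros; apply sig_eq; reflexivity).
Defined.

Lemma quot2_src (A : TwoCat) (p : quot2 A) :
  src (base A) (snd (proj1_sig p)) = src (base A) (fst (proj1_sig p)).
Proof.
destruct p as [p [a <-]]; simpl; rewrite src_src, src_tgt; reflexivity.
Qed.

Lemma quot2_tgt (A : TwoCat) (p : quot2 A) :
  tgt (base A) (snd (proj1_sig p)) = tgt (base A) (fst (proj1_sig p)).
Proof.
destruct p as [p [a <-]]; simpl; rewrite tgt_src, tgt_tgt; reflexivity.
Qed.

Lemma quot2_composable (A : TwoCat) (q p : quot2 A) :
  src (base A) (fst (proj1_sig q)) = tgt (base A) (fst (proj1_sig p)) ->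
  src (base A) (snd (proj1_sig q)) = tgt (base A) (snd (proj1_sig p)).
Proof.
intros e; rewrite quot2_src, quot2_tgt; exact e.
Qed.

Definition quot2_horiz (A : TwoCat) : cat_on (cell0 A) (quot2 A).
Proof.
unshelve refine {|
  src p := src (base A) (fst (proj1_sig p));
  tgt p := tgt (base A) (fst (proj1_sig p));
  idn x := exist _ (idn (base A) x, idn (base A) x) _;
  cmp q p e := exist _
    (cmp (base A) (fst (proj1_sig q)) (fst (proj1_sig p)) e,
     cmp (base A) (snd (proj1_sig q)) (snd (proj1_sig p)) (quot2_composable e)) _
|}.
- abstract (exists (idn (horiz A) x); rewrite <- idn_idn, src_idn, tgt_idn; reflexivity).
- abstract (destruct p as [p [a <-]], q as [q [b <-]]; simpl in e |- *;
  assert (h : src (horiz A) b = tgt (horiz A) a)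
    by (rewrite <- src_src, <- tgt_src; exact e);
  exists (cmp (horiz A) b a h); f_equal; [apply src_hcmp | apply tgt_hcmp]).
- abstract (intros; apply src_idn).
- abstract (intros; apply tgt_idn).
- abstract (intros; apply src_cmp).
- abstract (intros; apply tgt_cmp).
- abstract (intros p e; apply sig_eq; simpl;
    rewrite (surjective_pairing (proj1_sig p)); f_equal; apply cmp_idl_at;
    [reflexivity | symmetry; apply quot2_tgt]).
- abstract (intros p e; apply sig_eq; simpl;
    rewrite (surjective_pairing (proj1_sig p)); f_equal; apply cmp_idr_at;
    [reflexivity | symmetry; apply quot2_src]).
- abstract (intros; apply sig_eq; simpl; f_equal; apply cmp_assoc).
Defined.

Definition quot_2cat (A : TwoCat) : TwoCat.
Proof.
refine {| base := base A; vert := quot2_vert A; horiz := quot2_horiz A |}.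
- reflexivity.
- abstract (apply quot2_src).
- reflexivity.
- abstract (apply quot2_tgt).
- abstract (intros; apply sig_eq; reflexivity).
- abstract (intros; apply cmp_congr; reflexivity).
- abstract (intros; apply cmp_congr; reflexivity).
- abstract (intros; apply sig_eq; simpl; f_equal; apply cmp_congr; reflexivity).
- abstract (intros; apply sig_eq; simpl; f_equal; apply cmp_congr; reflexivity).
Defined.

Lemma quot_2cat_preorder (A : TwoCat) : is_2preorder (quot_2cat A).
Proof.
intros [[f g] p] [[f' g'] p']; simpl; intros <- <-; apply sig_eq; reflexivity.
Qed.

Definition quot_2functor (A B : TwoCat) (F : TwoFunctor A B) :
  TwoFunctor (quot_2cat A) (quot_2cat B).
Proof.
unshelve refine (@Build_TwoFunctor (quot_2cat A) (quot_2cat B) (map0 F) (map1 F)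
  (fun p => exist _ (map1 F (fst (proj1_sig p)), map1 F (snd (proj1_sig p))) _)
  (map_base F) _ _).
- abstract (destruct p as [p [a <-]]; exists (map2 F a);
  rewrite (on_src (map_vert F)), (on_tgt (map_vert F)); reflexivity).
- abstract (split; intros; try apply sig_eq; reflexivity).
- split; intros; try apply sig_eq; simpl.
  + apply (on_src (map_base F)).
  + apply (on_tgt (map_base F)).
  + rewrite (on_idn (map_base F)); reflexivity.
  + f_equal; apply (on_cmp (map_base F)).
Defined.

Definition reflectorI : Functor TwoCAT TwoPREORD.
Proof.
refine (@Build_Functor TwoCAT TwoPREORD
  (fun A => exist _ (quot_2cat A) (@quot_2cat_preorder A)) quot_2functor _ _).
- abstract (intros A; apply TwoFunctor_eq; try reflexivity;
  intros [[f g] p]; apply sig_eq; reflexivity).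
- abstract (intros A B D G F; apply TwoFunctor_eq; try reflexivity;
  intros p; apply sig_eq; reflexivity).
Defined.

Definition quot_unit (A : TwoCat) : TwoFunctor A (quot_2cat A).
Proof.
refine (@Build_TwoFunctor A (quot_2cat A) (fun x => x) (fun f => f)
  (fun a => exist _ (src (vert A) a, tgt (vert A) a) (ex_intro _ a eq_refl))
  (functor_on_id (base A)) _ _).
- split; intros; try reflexivity; apply sig_eq; simpl.
  + rewrite src_idn, tgt_idn; reflexivity.
  + rewrite src_cmp, tgt_cmp; reflexivity.
- split; intros; try apply sig_eq; simpl.
  + apply src_src.
  + apply tgt_src.
  + rewrite <- idn_idn, src_idn, tgt_idn; reflexivity.
  + f_equal; [apply src_hcmp | apply tgt_hcmp].
Defined.

(** A 2-preorder has only one 2-cell with a given vertical boundary. *)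
Definition quot2_rep (P : TwoPREORD) (p : quot2 (proj1_sig P)) :
  {a : cell2 (proj1_sig P) |
    (src (vert (proj1_sig P)) a, tgt (vert (proj1_sig P)) a) = proj1_sig p}.
Proof.
apply constructive_indefinite_description, (proj2_sig p).
Defined.

Lemma quot2_rep_src (P : TwoPREORD) (p : quot2 (proj1_sig P)) :
  src (vert (proj1_sig P)) (proj1_sig (quot2_rep p)) = fst (proj1_sig p).
Proof. exact (f_equal fst (proj2_sig (quot2_rep p))). Qed.

Lemma quot2_rep_tgt (P : TwoPREORD) (p : quot2 (proj1_sig P)) :
  tgt (vert (proj1_sig P)) (proj1_sig (quot2_rep p)) = snd (proj1_sig p).
Proof. exact (f_equal snd (proj2_sig (quot2_rep p))). Qed.

Definition quot_counit (P : TwoPREORD) :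
  TwoFunctor (quot_2cat (proj1_sig P)) (proj1_sig P).
Proof.
refine (@Build_TwoFunctor (quot_2cat (proj1_sig P)) (proj1_sig P)
  (fun x => x) (fun f => f) (fun p => proj1_sig (quot2_rep p))
  (functor_on_id (base (proj1_sig P))) _ _).
- split; intros.
  + apply quot2_rep_src.
  + apply quot2_rep_tgt.
  + apply (proj2_sig P); rewrite ?quot2_rep_src, ?quot2_rep_tgt, ?src_idn, ?tgt_idn;
      reflexivity.
  + apply (proj2_sig P); rewrite ?quot2_rep_src, ?quot2_rep_tgt, ?src_cmp, ?tgt_cmp;
      rewrite ?quot2_rep_src, ?quot2_rep_tgt; reflexivity.
- split; intros.
  + rewrite <- src_src, quot2_rep_src; reflexivity.
  + rewrite <- tgt_src, quot2_rep_src; reflexivity.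
  + apply (proj2_sig P).
    * etransitivity; [apply quot2_rep_src|].
      simpl; rewrite <- idn_idn, src_idn; reflexivity.
    * etransitivity; [apply quot2_rep_tgt|].
      simpl; rewrite <- idn_idn, tgt_idn; reflexivity.
  + apply (proj2_sig P).
    * etransitivity; [apply quot2_rep_src|]; unshelve erewrite src_hcmp.
      { rewrite !quot2_rep_src; exact e. }
      simpl; apply cmp_congr; symmetry; apply quot2_rep_src.
    * etransitivity; [apply quot2_rep_tgt|]; unshelve erewrite tgt_hcmp.
      { rewrite !quot2_rep_tgt; exact (@quot2_composable (proj1_sig P) g f e). }
      simpl; apply cmp_congr; symmetry; apply quot2_rep_tgt.
Defined.

Definition reflection : Adjunction reflectorI inclusionH.
Proof.
unshelve refine {|
  adj_unit := @Build_NatTrans TwoCAT TwoCAT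
    (functor_id TwoCAT) (functor_comp inclusionH reflectorI) quot_unit _;
  adj_counit := @Build_NatTrans TwoPREORD TwoPREORD
    (functor_comp reflectorI inclusionH) (functor_id TwoPREORD) quot_counit _
|}.
- abstract (intros A B F; apply TwoFunctor_eq; try reflexivity;
  intros a; apply sig_eq; simpl;
  rewrite (on_src (map_vert F)), (on_tgt (map_vert F)); reflexivity).
- intros P Q F; apply TwoFunctor_eq; try reflexivity.
  intros p; apply (proj2_sig Q); cbn.
  + rewrite (on_src (map_vert F)), quot2_rep_src; symmetry.
    exact (quot2_rep_src (P := Q) _).
  + rewrite (on_tgt (map_vert F)), quot2_rep_tgt; symmetry.
    exact (quot2_rep_tgt (P := Q) _).
- intros A; apply TwoFunctor_eq; try reflexivity.
  intros p; apply quot_2cat_preorder.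
  + exact (quot2_rep_src (P := reflectorI A) _).
  + exact (quot2_rep_tgt (P := reflectorI A) _).
- intros P; apply TwoFunctor_eq; try reflexivity.
  intros a; apply (proj2_sig P).
  + exact (quot2_rep_src (P := P) _).
  + exact (quot2_rep_tgt (P := P) _).
Defined.

Definition E_I : MorphismClass TwoCAT := inverted_class reflectorI.
Definition M_I : MorphismClass TwoCAT := cartesian_class reflection.
Definition E'_I : MorphismClass TwoCAT := stabilized_class TwoCAT_pullbacks E_I.
Definition Mstar_I : MorphismClass TwoCAT := localized_class TwoCAT_pullbacks M_I.

(* Main.v *)
Require Import Defs.
From Stdlib Require Import Bool.

Set Implicit Arguments.
Unset Strict Implicit.
Unset Printing Implicit Defensive.

(** Let the 2-category [B] have one object, one 1-cell and the group Z/2 as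
    2-cells, and let [A] be its terminal sub-2-category.  As [I] only remembers
    whether a 2-cell with a given boundary exists, it inverts the inclusion of
    [A] into [B].  Let [C] have one object, the 1-cells Z/2 and exactly one
    2-cell between any two of them; sending the 2-cell [u => v] to [v - u] is a
    2-functor from [C] to [B].  In the pullback of [A] along it only the
    identity 2-cells of [C] survive, so [I] does not invert the projection. *)

Lemma is_iso_comp (C : Category) (x y z : C) (g : Hom y z) (f : Hom x y) :
  is_iso g -> is_iso f -> is_iso (comp g f).
Proof.
intros [g' [gl gr]] [f' [fl fr]]; exists (comp f' g'); split.
- rewrite comp_assoc, <- (comp_assoc g'), gl, comp_idl; exact fl.
- rewrite comp_assoc, <- (comp_assoc f), fr, comp_idl; exact gr.
Qed.

Lemma fmap_is_iso (C D : Category) (F : Functor C D) (x y : C) (f : Hom x y) :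
  is_iso f -> is_iso (fmap F f).
Proof.
intros [g [l r]]; exists (fmap F g).
rewrite <- !fmap_comp, l, r, !fmap_id; split; reflexivity.
Qed.

Lemma pr2_ident_is_iso (C : Category) (A B : C) (f : Hom A B)
  (P : Pullback (ident B) f) : is_iso (pr2 P).
Proof.
assert (e : comp (ident B) f = comp f (ident A))
  by (rewrite comp_idl, comp_idr; reflexivity).
exists (pairing P f (ident A) e); split; [|apply pr2_pairing].
apply pairing_uniq; rewrite <- comp_assoc, comp_idr.
- rewrite pr1_pairing, <- (pr_comm P), comp_idl; reflexivity.
- rewrite pr2_pairing, comp_idl; reflexivity.
Qed.

Lemma is_iso_cancel_r (C : Category) (x y z : C) (g : Hom y z) (f : Hom x y) :
  is_iso f -> is_iso (comp g f) -> is_iso g.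
Proof.
intros [f' [l r]] gf.
assert (e : g = comp (comp g f) f') by (rewrite comp_assoc, r, comp_idr; reflexivity).
rewrite e; apply is_iso_comp; [exact gf|]; exists f; split; assumption.
Qed.

(** Pull back along [ident B]: then [pr1 = comp f (pr2)] with [pr2] invertible, so [I] inverts [f]
    as soon as it inverts [pr1]. *)
Lemma stabilized_inverted_sub (C D : Category) (pb : Pullbacks C)
  (I : Functor C D) (A B : C) (f : Hom A B) :
  stabilized_class pb (inverted_class I) f -> inverted_class I f.
Proof.
intros st; specialize (st B (ident B)); unfold inverted_class in *.
set (P := pb _ _ _ (ident B) f) in st.
apply (@is_iso_cancel_r D _ _ _ _ (fmap I (pr2 P))).
- apply fmap_is_iso, pr2_ident_is_iso.
- rewrite <- fmap_comp, <- (pr_comm P), comp_idl; exact st.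
Qed.

Lemma TwoFunctor_preorder_eq (A B : TwoCat) (F G : TwoFunctor A B) :
  is_2preorder B -> (forall x, map0 F x = map0 G x) ->
  (forall f, map1 F f = map1 G f) -> F = G.
Proof.
intros pre e0 e1; apply TwoFunctor_eq; trivial; intros a; apply pre.
- rewrite !(on_src (map_vert _)); apply e1.
- rewrite !(on_tgt (map_vert _)); apply e1.
Qed.

(** The inverse of [I(F)] sends the class of [b] to a 2-cell of [quot_2cat A], that is, to a
    boundary which some 2-cell of [A] realises. *)
Lemma E_I_reflects_2cells (A B : TwoCat) (F : TwoFunctor A B) :
  E_I (A := A) (B := B) F -> forall b : cell2 B, exists a : cell2 A,
    map1 F (src (vert A) a) = src (vert B) b /\
    map1 F (tgt (vert A) a) = tgt (vert B) b.
Proof.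
intros [G [_ r]] b.
pose (b' := map2 (quot_unit B) b).
pose proof (f_equal (fun K : TwoFunctor (quot_2cat B) (quot_2cat B) =>
  proj1_sig (map2 K b')) r) as e.
destruct (proj2_sig (map2 (G : TwoFunctor (quot_2cat B) (quot_2cat A)) b'))
  as [a ea].
exists a; split.
- exact (eq_trans (f_equal (fun p => map1 F (fst p)) ea) (f_equal fst e)).
- exact (eq_trans (f_equal (fun p => map1 F (snd p)) ea) (f_equal snd e)).
Qed.

(** A monoid seen as a category with one object. *)
Definition deloop (M : Type) (op : M -> M -> M) (e : M)
  (idl : forall x, op e x = x) (idr : forall x, op x e = x)
  (assoc : forall x y z, op (op x y) z = op x (op y z)) : cat_on unit M.
Proof.
refine {| src _ := tt; tgt _ := tt; idn _ := e; cmp g f _ := op g f |};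
  intros; auto.
all: match goal with |- tt = ?x => destruct x; reflexivity end.
Defined.

Definition terminal_cat : cat_on unit unit :=
  @deloop unit (fun _ _ => tt) tt (fun x => match x with tt => eq_refl end)
    (fun x => match x with tt => eq_refl end) (fun _ _ _ => eq_refl).

Definition Z2_cat : cat_on unit bool :=
  @deloop bool xorb false xorb_false_l xorb_false_r xorb_assoc_reverse.

Definition Z2_square_cat : cat_on unit (bool * bool).
Proof.
refine (@deloop _ (fun q p => (xorb (fst q) (fst p), xorb (snd q) (snd p)))
  (false, false) _ _ _).
- intros [u v]; reflexivity.
- intros [u v]; cbn; rewrite !xorb_false_r; reflexivity.
- intros; cbn; rewrite !xorb_assoc_reverse; reflexivity.
Defined.

Definition indiscrete_cat (O : Type) : cat_on O (O * O).
Proof.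
refine {| src := fst; tgt := snd; idn x := (x, x);
          cmp q p _ := (fst p, snd q) |}; try reflexivity.
- intros [u v] e; reflexivity.
- intros [u v] e; reflexivity.
Defined.

Definition terminal_2cat : TwoCat.
Proof.
refine {| base := terminal_cat; vert := terminal_cat; horiz := terminal_cat |};
  reflexivity.
Defined.

Definition Z2_2cells : TwoCat.
Proof.
refine {| base := terminal_cat; vert := Z2_cat; horiz := Z2_cat |};
  try reflexivity.
(* Both compositions are addition in Z/2, so interchange is its commutativity. *)
intros [] [] [] []; reflexivity.
Defined.

Definition Z2_indiscrete : TwoCat.
Proof.
refine {| base := Z2_cat; vert := indiscrete_cat bool; horiz := Z2_square_cat |};
  reflexivity.
Defined.

Definition terminal_inclusion : TwoFunctor terminal_2cat Z2_2cells.
Proof.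
refine (@Build_TwoFunctor terminal_2cat Z2_2cells
  (fun _ => tt) (fun _ => tt) (fun _ => false) _ _ _); split; reflexivity.
Defined.

Definition terminal_projection : TwoFunctor Z2_2cells terminal_2cat.
Proof.
refine (@Build_TwoFunctor Z2_2cells terminal_2cat
  (fun _ => tt) (fun _ => tt) (fun _ => tt) _ _ _); split; reflexivity.
Defined.

Definition Z2_difference : TwoFunctor Z2_indiscrete Z2_2cells.
Proof.
refine (@Build_TwoFunctor Z2_indiscrete Z2_2cells
  (fun _ => tt) (fun _ => tt) (fun p => xorb (snd p) (fst p)) _ _ _);
  split; try reflexivity.
- intros x; apply xorb_nilpotent.
(* Vertical composition telescopes: (w - v) + (v - u) = w - u. *)
- intros [v w] [u v'] e e'; cbn in *; subst.
  destruct u, v', w; reflexivity.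
(* Horizontal composition adds boundaries componentwise, and subtraction is additive. *)
- intros [[] []] [[] []] e e'; reflexivity.
Defined.

Lemma terminal_inclusion_in_E_I :
  E_I (A := terminal_2cat) (B := Z2_2cells) terminal_inclusion.
Proof.
(* Between 2-preorders only 0-cells and 1-cells need checking, and here there is one of each. *)
exists (quot_2functor terminal_projection); split;
  apply TwoFunctor_preorder_eq; try apply quot_2cat_preorder; intros []; reflexivity.
Qed.

Lemma terminal_inclusion_not_in_E'_I :
  ~ E'_I (A := terminal_2cat) (B := Z2_2cells) terminal_inclusion.
Proof.
intros st; specialize (st Z2_indiscrete Z2_difference).
(* The 2-cell [false => true] has difference [true], whereas every 2-cell of the pullback lies over
   the identity 2-cell [false]. *)
destruct (E_I_reflects_2cells st (false, true)) as [a [s t]].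
pose proof (fibprod_comm a) as e.
cbn in s, t, e; rewrite s, t in e; discriminate e.
Qed.

Theorem mainTheorem5 :
  proper_subclass E'_I E_I /\ (E'_I, Mstar_I) <> (E_I, M_I).
Proof.
split; [split|].
- intros A B f; apply stabilized_inverted_sub.
- exists terminal_2cat, Z2_2cells, terminal_inclusion; split.
  + exact terminal_inclusion_in_E_I.
  + exact terminal_inclusion_not_in_E'_I.
(* The two pairs already differ in their first components. *)
- intros e; apply (f_equal fst) in e; cbn in e.
  apply terminal_inclusion_not_in_E'_I; rewrite e.
  exact terminal_inclusion_in_E_I.
Qed.
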